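(* Let $L$ be a distributive lattice and $\theta$ a lattice congruence on $L$. The distributive lattice $L/\theta$ is a Boolean algebra if and only if there exist $a_0,b_0\in L$ such that the following conditions hold: (i) for each $x\in L$, $[a_0]_\theta\le [x]_\theta\le [b_0]_\theta$ (that is, $[a_0]_\theta$ is the bottom element and $[b_0]_\theta$ is the top element of $L/\theta$); (ii) for each $x\in L$ there exists $y\in L$ such that $(x\wedge y)\,\theta\, a_0$ and $(x\vee y)\,\theta\, b_0$.
   Context: A lattice congruence on $L$ is an equivalence relation $\theta$ such that $a\,\theta\, b$ implies $(a\vee c)\,\theta\,(b\vee c)$ and $(a\wedge c)\,\theta\,(b\wedge c)$ for all $a,b,c\in L$. $[x]_\theta$ denotes the class of $x$, and $L/\theta$ is the set of classes with operations $[x]_\theta\wedge[y]_\theta=[x\wedge y]_\theta$, $[x]_\theta\vee[y]_\theta=[x\vee y]_\theta$; it is a distributive lattice. A Boolean algebra is a bounded, complemented distributive lattice (the one-element lattice is allowed). *)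

(* Defs.v *)
From HB Require Import structures.
From mathcomp Require Import all_boot all_order.
From mathcomp Require Import boolp.

Set Implicit Arguments.
Unset Strict Implicit.
Unset Printing Implicit Defensive.

Import Order.Theory.

Local Open Scope order_scope.
Local Open Scope quotient_scope.

Record lattice_congruence (d : Order.disp_t) (L : distrLatticeType d)
    (theta : L -> L -> Prop) : Prop := LatticeCongruence {
  congr_refl : forall a, theta a a;
  congr_sym : forall a b, theta a b -> theta b a;
  congr_trans : forall a b c, theta a b -> theta b c -> theta a c;
  congr_join : forall a b c, theta a b -> theta (a `|` c) (b `|` c);
  congr_meet : forall a b c, theta a b -> theta (a `&` c) (b `&` c)
}.

Section Quotient.

Context (d : Order.disp_t) (L : distrLatticeType d) (theta : L -> L -> Prop).
Hypothesis Htheta : lattice_congruence theta.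

(* {eq_quot _} wants a boolean relation; `[< _ >] is classical truth. *)
Definition congr_rel : rel L := fun x y => `[< theta x y >].

Fact congr_rel_refl : reflexive congr_rel.
Proof. by move=> x; apply/asboolP/(congr_refl Htheta). Qed.

Fact congr_rel_sym : symmetric congr_rel.
Proof. by move=> x y; apply/asboolP/asboolP; apply: (congr_sym Htheta). Qed.

Fact congr_rel_trans : transitive congr_rel.
Proof.
move=> y x z /asboolP xy /asboolP yz.
by apply/asboolP; apply: (congr_trans Htheta) yz.
Qed.

Definition congr_equiv : equiv_rel L :=
  EquivRel congr_rel congr_rel_refl congr_rel_sym congr_rel_trans.

Definition congr_quot : Type := {eq_quot congr_equiv}.

HB.instance Definition _ := Choice.on congr_quot.
HB.instance Definition _ := EqQuotient.on congr_quot.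

Lemma congr_quotP (x y : L) :
  \pi_congr_quot x = \pi_congr_quot y <-> theta x y.
Proof.
split=> [/eqmodP /asboolP //|h].
by apply/eqmodP/asboolP.
Qed.

Definition congr_quot_meet : congr_quot -> congr_quot -> congr_quot :=
  lift_op2 congr_quot (@Order.meet d L).

Definition congr_quot_join : congr_quot -> congr_quot -> congr_quot :=
  lift_op2 congr_quot (@Order.join d L).

Lemma theta_repr (x : L) : theta (repr (\pi_congr_quot x)) x.
Proof. by apply/congr_quotP; rewrite reprK. Qed.

Lemma pi_meet :
  {morph \pi_congr_quot : x y / x `&` y >-> congr_quot_meet x y}.
Proof.
move=> x y; rewrite /congr_quot_meet -lock; apply/congr_quotP.
apply: (congr_sym Htheta).
apply: (congr_trans Htheta (congr_meet Htheta _ (theta_repr x))).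
by rewrite ![x `&` _]meetC; apply: congr_meet (theta_repr y).
Qed.

Lemma pi_join :
  {morph \pi_congr_quot : x y / x `|` y >-> congr_quot_join x y}.
Proof.
move=> x y; rewrite /congr_quot_join -lock; apply/congr_quotP.
apply: (congr_sym Htheta).
apply: (congr_trans Htheta (congr_join Htheta _ (theta_repr x))).
by rewrite ![x `|` _]joinC; apply: congr_join (theta_repr y).
Qed.

Definition congr_quot_le : rel congr_quot :=
  fun u v => congr_quot_meet u v == u.

Definition congr_quot_lt : rel congr_quot :=
  fun u v => (v != u) && congr_quot_le u v.

Fact congr_quot_meetC : commutative congr_quot_meet.
Proof. by elim/quotW=> x; elim/quotW=> y; rewrite -!pi_meet meetC. Qed.

Fact congr_quot_joinC : commutative congr_quot_join.
Proof. by elim/quotW=> x; elim/quotW=> y; rewrite -!pi_join joinC. Qed.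

Fact congr_quot_meetA : associative congr_quot_meet.
Proof.
by elim/quotW=> x; elim/quotW=> y; elim/quotW=> z; rewrite -!pi_meet meetA.
Qed.

Fact congr_quot_joinA : associative congr_quot_join.
Proof.
by elim/quotW=> x; elim/quotW=> y; elim/quotW=> z; rewrite -!pi_join joinA.
Qed.

Fact congr_quot_joinKI (v u : congr_quot) :
  congr_quot_meet u (congr_quot_join u v) = u.
Proof.
by elim/quotW: u => x; elim/quotW: v => y; rewrite -pi_join -pi_meet joinKI.
Qed.

Fact congr_quot_meetKU (v u : congr_quot) :
  congr_quot_join u (congr_quot_meet u v) = u.
Proof.
by elim/quotW: u => x; elim/quotW: v => y; rewrite -pi_meet -pi_join meetKU.
Qed.

Fact congr_quot_meetUl : left_distributive congr_quot_meet congr_quot_join.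
Proof.
elim/quotW=> x; elim/quotW=> y; elim/quotW=> z.
by rewrite -pi_join -!pi_meet -pi_join meetUl.
Qed.

Fact congr_quot_meetxx : idempotent_op congr_quot_meet.
Proof. by elim/quotW=> x; rewrite -pi_meet meetxx. Qed.

HB.instance Definition _ := Order.isMeetJoinDistrLattice.Build d congr_quot
  (fun _ _ => erefl) (fun _ _ => erefl)
  congr_quot_meetC congr_quot_joinC congr_quot_meetA congr_quot_joinA
  congr_quot_joinKI congr_quot_meetKU congr_quot_meetUl congr_quot_meetxx.

Lemma congr_quot_meetE (x y : L) :
  \pi_congr_quot x `&` \pi_congr_quot y = \pi_congr_quot (x `&` y).
Proof. by rewrite pi_meet. Qed.

Lemma congr_quot_joinE (x y : L) :
  \pi_congr_quot x `|` \pi_congr_quot y = \pi_congr_quot (x `|` y).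
Proof. by rewrite pi_join. Qed.

End Quotient.

Definition boolean_algebra (d : Order.disp_t) (B : distrLatticeType d) : Prop :=
  exists bot top : B,
    (forall u : B, bot <= u <= top) /\
    (forall u : B, exists v : B, u `&` v = bot /\ u `|` v = top).

Section CTB.

Context (d : Order.disp_t) (B : distrLatticeType d) (bot top : B).
Context (compl : B -> B).
Hypotheses (botle : forall u : B, bot <= u) (letop : forall u : B, u <= top).
Hypotheses (complU : forall u : B, u `|` compl u = top).
Hypotheses (complI : forall u : B, u `&` compl u = bot).

Definition ctb_sort : Type := B.

HB.instance Definition _ := Order.DistrLattice.on ctb_sort.
HB.instance Definition _ := Order.hasBottom.Build d ctb_sort botle.
HB.instance Definition _ := Order.hasTop.Build d ctb_sort letop.
HB.instance Definition _ :=
  Order.TBDistrLattice_hasComplement.Build d ctb_sort complU complI.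

Definition ctb_of : ctbDistrLatticeType d := ctb_sort.

End CTB.

(* The library structure carries the bounds and the complement as data;
   [boolean_algebra B] says that [B] can be so equipped. *)
Lemma boolean_algebraP (d : Order.disp_t) (B : distrLatticeType d) :
  boolean_algebra B <->
  exists C : ctbDistrLatticeType d, C = B :> distrLatticeType d.
Proof.
split=> [|[C <-]]; last first.
  exists \bot, \top; split=> u; first by rewrite le0x lex1.
  by exists (~` u); rewrite meetxC joinxC.
case=> bot [top [botle_letop]] /choice [compl complP].
have botle (u : B) : bot <= u by case/andP: (botle_letop u).
have letop (u : B) : u <= top by case/andP: (botle_letop u).
have complI u : u `&` compl u = bot by case: (complP u).
have complU u : u `|` compl u = top by case: (complP u).
exists (ctb_of botle letop complU complI).
case: B bot top compl {botle_letop complP} botle letop complI complU.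
by move=> T [].
Qed.

(* Main.v *)
Require Import Defs.
From mathcomp Require Import all_boot all_order.

Local Open Scope order_scope.
Local Open Scope quotient_scope.

(** The projection onto [congr_quot Htheta] is a surjective lattice morphism whose kernel is
    [theta]. Surjectivity ([quotW]) trades quantifiers over classes for quantifiers over [L]; the
    morphism laws and [congr_quotP] turn equations between classes into [theta]-relations, so bounds
    and complements transfer both ways. *)

Theorem theorem4p1 (d : Order.disp_t) (L : distrLatticeType d)
    (theta : L -> L -> Prop) (Htheta : lattice_congruence theta) :
  boolean_algebra (congr_quot Htheta) <->
  exists a0 b0 : L,
    (forall x : L,
       \pi_(congr_quot Htheta) a0 <= \pi_(congr_quot Htheta) x
         <= \pi_(congr_quot Htheta) b0) /\
    (forall x : L, exists y : L,
       theta (x `&` y) a0 /\ theta (x `|` y) b0).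
Proof.
split=> [[bot [top [bounds compl]]] | [a0 [b0 [bounds compl]]]].
  (* The witnesses [a0] and [b0] are representatives of the bottom and top classes. *)
  elim/quotW: bot bounds compl => a0; elim/quotW: top => b0 bounds compl.
  exists a0, b0; split=> x; first exact: bounds.
  have [v] := compl (\pi_(congr_quot Htheta) x).
  elim/quotW: v => y; rewrite congr_quot_meetE congr_quot_joinE.
  by case=> /congr_quotP xIy /congr_quotP xUy; exists y.
exists (\pi_(congr_quot Htheta) a0), (\pi_(congr_quot Htheta) b0).
split; elim/quotW=> x; first exact: bounds.
(* The class of any [y] given by (ii) complements the class of [x]. *)
have [y [xIy xUy]] := compl x; exists (\pi_(congr_quot Htheta) y).
by rewrite congr_quot_meetE congr_quot_joinE; split; apply/congr_quotP.
Qed.
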